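(* For every $N\ge 3$, $\dim\mathfrak{e}_{D_N}=N^2-N$.
   Context: All Lie algebras are over $\mathbb{C}$. For $N=m+1$ with $m\ge 2$, the Dynkin diagram $D_{N}$ has nodes $\bar 1,1,2,\dots,m$ with edges $\bar1-2$, $1-2$, and $i-(i+1)$ for $2\le i\le m-1$. The electrical Lie algebra $\mathfrak{e}_{D_{N}}$ is generated by $e_{\bar1},e_1,e_2,\dots,e_m$ subject to: $[e_a,[e_a,e_b]]=-2e_a$ whenever $a,b$ are adjacent nodes (in either order), and $[e_a,e_b]=0$ whenever $a\ne b$ are non-adjacent nodes. *)

(* Defs.v *)
From HB Require Import structures.
From mathcomp Require Import all_boot all_order all_algebra.
From mathcomp Require Import boolp reals.
From mathcomp Require Import complex.

Set Implicit Arguments.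
Unset Strict Implicit.
Unset Printing Implicit Defensive.

Import GRing.Theory.

Local Open Scope ring_scope.
Local Open Scope quotient_scope.

HB.mixin Record Lmodule_isLieAlgebra (F : fieldType) L of GRing.Lmodule F L := {
  lie_bracket : L -> L -> L;
  lie_bracketDl : forall x y z,
    lie_bracket (x + y) z = lie_bracket x z + lie_bracket y z;
  lie_bracketDr : forall x y z,
    lie_bracket x (y + z) = lie_bracket x y + lie_bracket x z;
  lie_bracketZl : forall c x y,
    lie_bracket (c *: x) y = c *: lie_bracket x y;
  lie_bracketZr : forall c x y,
    lie_bracket x (c *: y) = c *: lie_bracket x y;
  lie_bracketxx : forall x, lie_bracket x x = 0;
  lie_jacobi : forall x y z,
    lie_bracket x (lie_bracket y z) + lie_bracket y (lie_bracket z x)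
      + lie_bracket z (lie_bracket x y) = 0
}.

#[short(type="lieAlgType")]
HB.structure Definition LieAlgebra (F : fieldType) :=
  { L of GRing.Lmodule F L & Lmodule_isLieAlgebra F L }.

Inductive lie_term (F : fieldType) (X : Type) : Type :=
| LGen of X
| LZero
| LOpp of lie_term F X
| LAdd of lie_term F X & lie_term F X
| LScale of F & lie_term F X
| LBracket of lie_term F X & lie_term F X.

Arguments LGen {F X} _.
Arguments LZero {F X}.

(* The least congruence on terms that contains R and the Lie algebra axioms:
   the terms modulo lie_eq R form the Lie algebra with generators X and
   relations s = t for R s t. *)
Inductive lie_eq (F : fieldType) (X : Type)
    (R : lie_term F X -> lie_term F X -> Prop) :
    lie_term F X -> lie_term F X -> Prop :=
| lie_eq_rel s t : R s t -> lie_eq R s t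
| lie_eq_refl t : lie_eq R t t
| lie_eq_sym s t : lie_eq R s t -> lie_eq R t s
| lie_eq_trans s t u : lie_eq R s t -> lie_eq R t u -> lie_eq R s u
| lie_eq_opp s t : lie_eq R s t -> lie_eq R (LOpp s) (LOpp t)
| lie_eq_add s s' t t' : lie_eq R s s' -> lie_eq R t t' ->
    lie_eq R (LAdd s t) (LAdd s' t')
| lie_eq_scale c s t : lie_eq R s t -> lie_eq R (LScale c s) (LScale c t)
| lie_eq_bracket s s' t t' : lie_eq R s s' -> lie_eq R t t' ->
    lie_eq R (LBracket s t) (LBracket s' t')
| lie_eq_addA s t u : lie_eq R (LAdd s (LAdd t u)) (LAdd (LAdd s t) u)
| lie_eq_addC s t : lie_eq R (LAdd s t) (LAdd t s)
| lie_eq_add0 t : lie_eq R (LAdd LZero t) t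
| lie_eq_addN t : lie_eq R (LAdd (LOpp t) t) LZero
| lie_eq_scaleA a b t :
    lie_eq R (LScale a (LScale b t)) (LScale (a * b) t)
| lie_eq_scale1 t : lie_eq R (LScale 1 t) t
| lie_eq_scaleDr c s t :
    lie_eq R (LScale c (LAdd s t)) (LAdd (LScale c s) (LScale c t))
| lie_eq_scaleDl a b t :
    lie_eq R (LScale (a + b) t) (LAdd (LScale a t) (LScale b t))
| lie_eq_bracketDl s t u :
    lie_eq R (LBracket (LAdd s t) u) (LAdd (LBracket s u) (LBracket t u))
| lie_eq_bracketDr s t u :
    lie_eq R (LBracket s (LAdd t u)) (LAdd (LBracket s t) (LBracket s u))
| lie_eq_bracketZl c s t :
    lie_eq R (LBracket (LScale c s) t) (LScale c (LBracket s t))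
| lie_eq_bracketZr c s t :
    lie_eq R (LBracket s (LScale c t)) (LScale c (LBracket s t))
| lie_eq_bracketxx t : lie_eq R (LBracket t t) LZero
| lie_eq_jacobi s t u :
    lie_eq R (LAdd (LAdd (LBracket s (LBracket t u))
                         (LBracket t (LBracket u s)))
                   (LBracket u (LBracket s t))) LZero.

Definition lie_eqb (F : fieldType) (X : Type)
    (R : lie_term F X -> lie_term F X -> Prop) :
  rel {classic lie_term F X} := fun s t => `[< lie_eq R s t >].

Lemma lie_eqb_equiv (F : fieldType) (X : Type)
    (R : lie_term F X -> lie_term F X -> Prop) :
  equiv_class_of (lie_eqb R).
Proof.
split=> [t | s t | t s u].
- exact/asboolP/lie_eq_refl.
- by apply/asboolP/asboolP; apply: lie_eq_sym.
- move=> /asboolP st /asboolP tu; apply/asboolP; exact: lie_eq_trans st tu.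
Qed.

Canonical lie_eqb_equiv_rel (F : fieldType) (X : Type)
    (R : lie_term F X -> lie_term F X -> Prop) :=
  EquivRelPack (lie_eqb_equiv R).

Definition presented_lie (F : fieldType) (X : Type)
    (R : lie_term F X -> lie_term F X -> Prop) : Type :=
  {eq_quot lie_eqb R}.

HB.instance Definition _ (F : fieldType) (X : Type)
    (R : lie_term F X -> lie_term F X -> Prop) :=
  Choice.on (presented_lie R).
HB.instance Definition _ (F : fieldType) (X : Type)
    (R : lie_term F X -> lie_term F X -> Prop) :=
  EqQuotient.on (presented_lie R).

Section PresentedLieTheory.
Variables (F : fieldType) (X : Type).
Variable R : lie_term F X -> lie_term F X -> Prop.
Local Notation T := (lie_term F X).
Local Notation Q := (presented_lie R).

Definition lie_class (t : T) : Q := \pi_Q (t : {classic T}).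
Definition lie_repr (x : Q) : T := repr x.

Lemma lie_reprK (x : Q) : lie_class (lie_repr x) = x.
Proof. exact: reprK. Qed.

Lemma lie_classP (s t : T) : lie_class s = lie_class t <-> lie_eq R s t.
Proof.
split=> [/eqmodP /asboolP // | st].
by apply/eqmodP/asboolP.
Qed.

Lemma lie_repr_class (t : T) : lie_eq R (lie_repr (lie_class t)) t.
Proof. by apply/lie_classP; rewrite lie_reprK. Qed.

Definition lie_zero : Q := lie_class LZero.
Definition lie_opp (x : Q) : Q := lie_class (LOpp (lie_repr x)).
Definition lie_add (x y : Q) : Q := lie_class (LAdd (lie_repr x) (lie_repr y)).
Definition lie_scale (c : F) (x : Q) : Q := lie_class (LScale c (lie_repr x)).
Definition lie_brack (x y : Q) : Q :=
  lie_class (LBracket (lie_repr x) (lie_repr y)).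

Lemma lie_oppE t : lie_opp (lie_class t) = lie_class (LOpp t).
Proof. exact/lie_classP/lie_eq_opp/lie_repr_class. Qed.

Lemma lie_addE s t :
  lie_add (lie_class s) (lie_class t) = lie_class (LAdd s t).
Proof. by apply/lie_classP/lie_eq_add; apply: lie_repr_class. Qed.

Lemma lie_scaleE c t : lie_scale c (lie_class t) = lie_class (LScale c t).
Proof. exact/lie_classP/lie_eq_scale/lie_repr_class. Qed.

Lemma lie_brackE s t :
  lie_brack (lie_class s) (lie_class t) = lie_class (LBracket s t).
Proof. by apply/lie_classP/lie_eq_bracket; apply: lie_repr_class. Qed.

Lemma lie_ind (P : Q -> Prop) : (forall t, P (lie_class t)) -> forall x, P x.
Proof. by move=> H x; rewrite -(lie_reprK x). Qed.

Definition lieE := (lie_oppE, lie_addE, lie_scaleE, lie_brackE).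

Lemma lie_addA : associative lie_add.
Proof.
elim/lie_ind=> s; elim/lie_ind=> t; elim/lie_ind=> u; rewrite !lieE.
exact/lie_classP/lie_eq_addA.
Qed.

Lemma lie_addC : commutative lie_add.
Proof.
elim/lie_ind=> s; elim/lie_ind=> t; rewrite !lieE.
exact/lie_classP/lie_eq_addC.
Qed.

Lemma lie_add0 : left_id lie_zero lie_add.
Proof.
by elim/lie_ind=> t; rewrite /lie_zero !lieE; apply/lie_classP/lie_eq_add0.
Qed.

Lemma lie_addN : left_inverse lie_zero lie_opp lie_add.
Proof. by elim/lie_ind=> t; rewrite !lieE; apply/lie_classP/lie_eq_addN. Qed.

HB.instance Definition _ :=
  GRing.isZmodule.Build Q lie_addA lie_addC lie_add0 lie_addN.

Lemma lie_scaleA a b x : lie_scale a (lie_scale b x) = lie_scale (a * b) x.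
Proof.
by elim/lie_ind: x => t; rewrite !lieE; apply/lie_classP/lie_eq_scaleA.
Qed.

Lemma lie_scale1 : left_id 1 lie_scale.
Proof. by elim/lie_ind=> t; rewrite !lieE; apply/lie_classP/lie_eq_scale1. Qed.

Lemma lie_scaleDr : right_distributive lie_scale +%R.
Proof.
move=> c; elim/lie_ind=> s; elim/lie_ind=> t.
by rewrite /GRing.add /= !lieE; apply/lie_classP/lie_eq_scaleDr.
Qed.

Lemma lie_scaleDl x : {morph lie_scale^~ x : a b / a + b}.
Proof.
move=> a b; elim/lie_ind: x => t.
by rewrite [RHS]/GRing.add /= !lieE; apply/lie_classP/lie_eq_scaleDl.
Qed.

HB.instance Definition _ := GRing.Zmodule_isLmodule.Build F Q
  lie_scaleA lie_scale1 lie_scaleDr lie_scaleDl.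

Lemma lie_brackDl (x y z : Q) :
  lie_brack (x + y) z = lie_brack x z + lie_brack y z.
Proof.
elim/lie_ind: x => s; elim/lie_ind: y => t; elim/lie_ind: z => u.
by rewrite /GRing.add /= !lieE; apply/lie_classP/lie_eq_bracketDl.
Qed.

Lemma lie_brackDr (x y z : Q) :
  lie_brack x (y + z) = lie_brack x y + lie_brack x z.
Proof.
elim/lie_ind: x => s; elim/lie_ind: y => t; elim/lie_ind: z => u.
by rewrite /GRing.add /= !lieE; apply/lie_classP/lie_eq_bracketDr.
Qed.

Lemma lie_brackZl c (x y : Q) : lie_brack (c *: x) y = c *: lie_brack x y.
Proof.
elim/lie_ind: x => s; elim/lie_ind: y => t.
by rewrite /GRing.scale /= !lieE; apply/lie_classP/lie_eq_bracketZl.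
Qed.

Lemma lie_brackZr c (x y : Q) : lie_brack x (c *: y) = c *: lie_brack x y.
Proof.
elim/lie_ind: x => s; elim/lie_ind: y => t.
by rewrite /GRing.scale /= !lieE; apply/lie_classP/lie_eq_bracketZr.
Qed.

Lemma lie_brackxx (x : Q) : lie_brack x x = 0.
Proof.
by elim/lie_ind: x => t; rewrite !lieE; apply/lie_classP/lie_eq_bracketxx.
Qed.

Lemma lie_brack_jacobi (x y z : Q) :
  lie_brack x (lie_brack y z) + lie_brack y (lie_brack z x)
    + lie_brack z (lie_brack x y) = 0.
Proof.
elim/lie_ind: x => s; elim/lie_ind: y => t; elim/lie_ind: z => u.
by rewrite /GRing.add /= !lieE; apply/lie_classP/lie_eq_jacobi.
Qed.

HB.instance Definition _ := Lmodule_isLieAlgebra.Build F Q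
  lie_brackDl lie_brackDr lie_brackZl lie_brackZr lie_brackxx lie_brack_jacobi.

Definition lie_gen (a : X) : Q := lie_class (LGen a).

Fixpoint lie_eval (L : lieAlgType F) (f : X -> L) (t : T) : L :=
  match t with
  | LGen a => f a
  | LZero => 0
  | LOpp t => - lie_eval f t
  | LAdd s t => lie_eval f s + lie_eval f t
  | LScale c t => c *: lie_eval f t
  | LBracket s t => lie_bracket (lie_eval f s) (lie_eval f t)
  end.

Lemma lie_eval_gen (t : T) : lie_eval lie_gen t = lie_class t.
Proof.
by elim: t => [a||t /= ->|s /= -> t ->|c t /= ->|s /= -> t ->] //=;
  rewrite -lieE.
Qed.

Lemma lie_gen_rel (s t : T) : R s t -> lie_eval lie_gen s = lie_eval lie_gen t.
Proof. by move=> st; rewrite !lie_eval_gen; apply/lie_classP/lie_eq_rel. Qed.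

Lemma lie_eval_eq (L : lieAlgType F) (f : X -> L) :
  (forall s t, R s t -> lie_eval f s = lie_eval f t) ->
  forall s t, lie_eq R s t -> lie_eval f s = lie_eval f t.
Proof.
move=> fR s t; elim=> /=.
- exact: fR.
- by [].
- by [].
- by move=> ? ? ? _ -> _ ->.
- by move=> ? ? _ ->.
- by move=> ? ? ? ? _ -> _ ->.
- by move=> ? ? ? _ ->.
- by move=> ? ? ? ? _ -> _ ->.
- by move=> *; rewrite addrA.
- by move=> *; rewrite addrC.
- by move=> *; rewrite add0r.
- by move=> *; rewrite addNr.
- by move=> *; rewrite scalerA.
- by move=> *; rewrite scale1r.
- by move=> *; rewrite scalerDr.
- by move=> *; rewrite scalerDl.
- by move=> *; rewrite lie_bracketDl.
- by move=> *; rewrite lie_bracketDr.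
- by move=> *; rewrite lie_bracketZl.
- by move=> *; rewrite lie_bracketZr.
- by move=> *; rewrite lie_bracketxx.
- by move=> *; rewrite lie_jacobi.
Qed.

Lemma presented_lie_universal (L : lieAlgType F) (f : X -> L) :
  (forall s t, R s t -> lie_eval f s = lie_eval f t) ->
  exists! g : Q -> L,
    [/\ linear g,
        {morph g : x y / lie_bracket x y >-> lie_bracket x y}
      & forall a, g (lie_gen a) = f a].
Proof.
move=> fR; pose g (x : Q) := lie_eval f (lie_repr x).
have gE t : g (lie_class t) = lie_eval f t.
  by apply: lie_eval_eq => //; exact: lie_repr_class.
exists g; split.
  split=> [c x y | x y | a]; last by rewrite gE.
  - elim/lie_ind: x => s; elim/lie_ind: y => t.
    by rewrite {1}/GRing.add {1}/GRing.scale /= !lieE !gE.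
  - elim/lie_ind: x => s; elim/lie_ind: y => t.
    by rewrite {1}/lie_bracket /= !lieE !gE.
move=> h [hlin hbr hgen]; apply/funext; elim/lie_ind=> t; rewrite gE.
have hD x y : h (x + y) = h x + h y.
  by have := hlin 1 x y; rewrite !scale1r.
have h0 : h 0 = 0 by apply: (addrI (h 0)); rewrite -hD !addr0.
have hZ c x : h (c *: x) = c *: h x by have := hlin c x 0; rewrite h0 !addr0.
have hN x : h (- x) = - h x by rewrite -scaleN1r hZ scaleN1r.
rewrite -lie_eval_gen.
elim: t => [a||t IH|s IHs t IHt|c t IH|s IHs t IHt] /=.
- by rewrite hgen.
- by rewrite h0.
- by rewrite hN IH.
- by rewrite hD IHs IHt.
- by rewrite hZ IH.
- by rewrite hbr IHs IHt.
Qed.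

End PresentedLieTheory.

Inductive electrical_rel (F : fieldType) (X : eqType) (adj : rel X) :
    lie_term F X -> lie_term F X -> Prop :=
| electrical_adj (a b : X) : adj a b ->
    electrical_rel adj (LBracket (LGen a) (LBracket (LGen a) (LGen b)))
                       (LScale (- 2%:R) (LGen a))
| electrical_nonadj (a b : X) : a != b -> ~~ adj a b ->
    electrical_rel adj (LBracket (LGen a) (LGen b)) LZero.

(* The node \bar 1 is encoded as 0 : 'I_N, and the node i with 1 <= i <= N - 1
   as i : 'I_N. *)
Definition dynkinD_edge (i j : nat) : bool :=
  ((i == 0) && (j == 2) || (0 < i) && (j == i.+1))%N.

Definition dynkinD_adj (N : nat) : rel 'I_N :=
  fun a b => dynkinD_edge a b || dynkinD_edge b a.

Definition electrical_lieD (F : fieldType) (N : nat) : lieAlgType F :=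
  presented_lie (@electrical_rel F 'I_N (@dynkinD_adj N)).

(* \dim of vector.v only applies to vectType, that is, to spaces that come
   with a finite basis. *)
Definition has_dim (F : fieldType) (V : lmodType F) (d : nat) : Prop :=
  exists b : 'I_d -> V,
    (forall c : 'I_d -> F, \sum_i c i *: b i = 0 -> forall i, c i = 0) /\
    (forall v : V, exists c : 'I_d -> F, v = \sum_i c i *: b i).

(* Main.v *)
(** Put [d = e_bar1 - e_1] and [d_1 = d, d_(j+1) = [e_(j+1), d_j]].  The element
    [e_1 + d/2] and the [e_a] with [a >= 2] act on the span of the [d_j] by
    [e_a d_(a-1) = e_a d_(a+1) = d_a], all other products being zero, and the
    Serre-type identity for [e_1, e_2] applied to [d_j] forces all the brackets
    [[d_i, [d_j, d_k]]] to vanish.  Hence the ideal generated by [d] is spanned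
    by the [d_j] and the [[d_i, d_j]], [i < j], while the subalgebra generated
    by [e_1, ..., e_m] is spanned by the [m(m+1)/2] iterated brackets
    [[e_j, ... [e_(i+1), e_i]]].  This gives [m(m+1)/2 + m + m(m-1)/2 = N^2 - N]
    spanning elements.

    They are independent because their images are so in a matrix model, which
    is [S^2 W] acting on the free 2-step nilpotent Lie algebra [W + wedge^2 W],
    with [W] spanned by vectors [v_1, ..., v_m, w]; a skew form on [W] pairs
    [v_i] with its neighbours only, and [w] with [v_1] only.  There [e_a] is a
    multiple of [v_a^2] and [d] is a multiple of [2 v_1 + v_1 wedge w]. *)
From HB Require Import structures.
Require Import Defs.
From mathcomp Require Import all_boot all_order all_algebra.
From mathcomp Require Import reals complex.
From mathcomp Require Import zify ring.

Set Implicit Arguments.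
Unset Strict Implicit.
Unset Printing Implicit Defensive.

Import GRing.Theory.
Local Open Scope ring_scope.

Local Notation "\[ x , y ]" := (lie_bracket x y) (at level 0).

(** * Linear spans of arbitrary sets of vectors *)

Section Span.
Variables (F : fieldType) (V : lmodType F).
Implicit Types (S : V -> Prop).

Inductive spanned S : V -> Prop :=
| spanned_gen x of S x : spanned S x
| spanned_zero : spanned S 0
| spanned_add x y of spanned S x & spanned S y : spanned S (x + y)
| spanned_scale c x of spanned S x : spanned S (c *: x).

Lemma spanned_opp S x : spanned S x -> spanned S (- x).
Proof. by rewrite -scaleN1r; apply: spanned_scale. Qed.

Lemma spanned_muln S x n : spanned S x -> spanned S (x *+ n).
Proof. by rewrite -scaler_nat; apply: spanned_scale. Qed.

Lemma spanned_divn S x n : n%:R != 0 :> F -> spanned S (x *+ n) -> spanned S x.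
Proof.
move=> n0 Sx; rewrite -[x]scale1r -(mulVf n0) -scalerA scaler_nat.
exact: spanned_scale.
Qed.

Lemma spanned_sub S S' x :
  (forall y, S y -> spanned S' y) -> spanned S x -> spanned S' x.
Proof.
move=> sub; elim=> {x} [x /sub // | | x y _ Sx _ Sy | c x _ Sx].
- exact: spanned_zero.
- exact: spanned_add.
- exact: spanned_scale.
Qed.

End Span.

(** * Identities in Lie algebras, and stability of spans under brackets *)

Section Lie.
Variables (F : fieldType) (L : lieAlgType F).
Hypothesis nz2 : 2%:R != 0 :> F.
Implicit Types (x y z a b : L) (S : L -> Prop).

Lemma mulr2n_inj x y : x *+ 2 = y *+ 2 -> x = y.
Proof. by rewrite -!scaler_nat => /(scalerI nz2). Qed.

Lemma lie0r x : \[x, 0] = 0.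
Proof. by rewrite -[0 in LHS](scale0r 0) lie_bracketZr scale0r. Qed.

Lemma lieNr x y : \[x, - y] = - \[x, y].
Proof. by rewrite -scaleN1r lie_bracketZr scaleN1r. Qed.

Lemma lieNl x y : \[- x, y] = - \[x, y].
Proof. by rewrite -scaleN1r lie_bracketZl scaleN1r. Qed.

Lemma lieBr x y z : \[x, y - z] = \[x, y] - \[x, z].
Proof. by rewrite lie_bracketDr lieNr. Qed.

Lemma lieMnr x y n : \[x, y *+ n] = \[x, y] *+ n.
Proof. by rewrite -scaler_nat lie_bracketZr scaler_nat. Qed.

Lemma lieMnl x y n : \[x *+ n, y] = \[x, y] *+ n.
Proof. by rewrite -scaler_nat lie_bracketZl scaler_nat. Qed.

Lemma lieC x y : \[x, y] = - \[y, x].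
Proof.
apply/eqP; rewrite -addr_eq0; apply/eqP.
by have := lie_bracketxx (x + y);
  rewrite lie_bracketDl !lie_bracketDr !lie_bracketxx addr0 add0r.
Qed.

Lemma lie_leibniz x y z : \[x, \[y, z]] = \[\[x, y], z] + \[y, \[x, z]].
Proof.
have /eqP := lie_jacobi x y z.
rewrite addr_eq0 => /eqP /(canRL (addrK _)) ->.
by rewrite -lieC -lieNr -lieC.
Qed.

Lemma lie_bracket_bracketl x y z :
  \[\[x, y], z] = \[x, \[y, z]] - \[y, \[x, z]].
Proof. by rewrite lie_leibniz addrK. Qed.

Lemma lie_comm x y z : \[x, y] = 0 -> \[x, \[y, z]] = \[y, \[x, z]].
Proof.
by move=> xy; rewrite lie_leibniz xy (lieC 0) lie0r oppr0 add0r.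
Qed.

(** Since [ad b] is a derivation killing [y], its square sends [[a, y]] to [[[b, [b, a]], y] = -2
    [b, y] = 0]. *)
Lemma lie_ad_sq a b y : \[b, \[b, a]] = - (b *+ 2) -> \[b, y] = 0 ->
  \[b, \[b, \[a, y]]] = 0.
Proof.
move=> ba by0; rewrite (lie_leibniz b a) by0 lie0r addr0 lie_leibniz ba by0.
by rewrite lie0r addr0 lieNl lieMnl by0 mul0rn oppr0.
Qed.

(** With [A = ad a] and [B = ad b] the relation reads [A^2 B - 2 A B A + B A^2 = -2 A]; this is its
    value at [y], solved for the middle term. *)
Lemma lie_serre a b y : \[a, \[a, b]] = - (a *+ 2) ->
  \[a, \[b, \[a, y]]] *+ 2
  = \[a, \[a, \[b, y]]] + \[b, \[a, \[a, y]]] + \[a, y] *+ 2.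
Proof.
move=> ab; have -> : \[a, y] *+ 2 = - \[\[a, \[a, b]], y].
  by rewrite ab lieNl opprK lieMnl.
rewrite (lie_bracket_bracketl a) !(lie_bracket_bracketl a b) lieBr.
move: \[a, \[a, \[b, y]]] \[a, \[b, \[a, y]]] \[b, \[a, \[a, y]]].
move=> p q s.
rewrite [in RHS]opprB opprB [q - s + _]addrC addrACA.
by rewrite ![_ + (q - _)]addrCA !subrr addr0.
Qed.

(** Translates the relation of the node bar 1, whose generator is [a + d] with [a] that of node 1,
    into one on [d]. It is read forwards in the electrical algebra and backwards in the model. *)
Lemma lie_add_ad_sq a b d : \[a, d] = 0 -> \[a, \[a, b]] = - (a *+ 2) ->
  \[a + d, \[a + d, b]] = - ((a + d) *+ 2) <->
  \[a, \[b, d]] *+ 2 = d *+ 2 - \[d, \[b, d]].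
Proof.
move=> ad ab.
have -> : \[a + d, \[a + d, b]]
    = - (a *+ 2) - (\[a, \[b, d]] *+ 2 + \[d, \[b, d]]).
  rewrite lie_bracketDl [\[a + d, b]]lie_bracketDl !lie_bracketDr ab.
  rewrite (lieC d b) !lieNr -(lie_comm _ ad) (lieC d b) lieNr.
  by rewrite !addrA mulr2n !opprD !addrA.
have -> : - ((a + d) *+ 2) = - (a *+ 2) - d *+ 2 by rewrite mulrnDl opprD.
split=> [/addrI /oppr_inj <- | ->].
  by rewrite addrK.
by rewrite subrK.
Qed.

Lemma spanned_lie S S' x : (forall y, S y -> spanned S' \[x, y]) ->
  forall y, spanned S y -> spanned S' \[x, y].
Proof.
move=> SS' y; elim=> {y} [y /SS' // | | y z _ Sy _ Sz | c y _ Sy].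
- by rewrite lie0r; apply: spanned_zero.
- by rewrite lie_bracketDr; apply: spanned_add.
- by rewrite lie_bracketZr; apply: spanned_scale.
Qed.

(** [ad [x, y]] is the commutator of [ad x] and [ad y]. *)
Lemma spanned_stable_bracket S x y :
  (forall z, spanned S z -> spanned S \[x, z]) ->
  (forall z, spanned S z -> spanned S \[y, z]) ->
  forall z, spanned S z -> spanned S \[\[x, y], z].
Proof.
move=> Sx Sy z Sz; rewrite lie_bracket_bracketl.
by apply: spanned_add; [|apply: spanned_opp]; auto.
Qed.

End Lie.

(** * Spanning the subalgebra of type A by iterated brackets *)

Definition path_adj (i j : nat) : bool := (j == i.+1) || (i == j.+1).

(* The nodes are numbered from 0: [e a] stands for the generator e_(a+1). *)
Section TypeA.
Variables (F : fieldType) (L : lieAlgType F) (m : nat) (e : nat -> L).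
Hypothesis nz2 : 2%:R != 0 :> F.
Hypothesis e_adj : forall a b, (a < m)%N -> (b < m)%N -> path_adj a b ->
  \[e a, \[e a, e b]] = - (e a *+ 2).
Hypothesis e_far : forall a b, (a.+1 < b)%N -> (b < m)%N -> \[e b, e a] = 0.

(** The analogue of a root vector for [alpha_i + ... + alpha_(i+k)]. *)
Fixpoint chain (i k : nat) : L :=
  if k is k'.+1 then \[e (i + k), chain i k'] else e i.

Definition chains (n : nat) (x : L) : Prop :=
  exists i k, (i + k < n)%N /\ x = chain i k.

Lemma chain_far i k b : (i + k < b.-1)%N -> (b < m)%N ->
  \[e b, chain i k] = 0.
Proof.
elim: k => [|k IH] /= ikb bm; first by apply: e_far => //; lia.
by rewrite lie_comm ?IH ?lie0r //; [lia | apply: e_far; lia].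
Qed.

Lemma spanned_chains_sub n n' x : (n <= n')%N ->
  spanned (chains n) x -> spanned (chains n') x.
Proof.
move=> nn'; apply: spanned_sub => y [i [k [ikn ->]]]; apply: spanned_gen.
by exists i, k; split=> //; lia.
Qed.

(** [e n] kills the chains of top index below [n - 1] and lengthens those of top index [n - 1]. *)
Lemma spanned_chains_next n x : (n < m)%N ->
  spanned (chains n) x -> spanned (chains n.+1) \[e n, x].
Proof.
move=> nm; apply: spanned_lie => y [i [k [ikn ->]]].
have [ikn1 | ikn1] := ltnP (i + k) n.-1.
  by rewrite chain_far //; apply: spanned_zero.
have nE : n = (i + k.+1)%N by lia.
by apply: spanned_gen; exists i, k.+1; rewrite /= -nE; split=> //; lia.
Qed.

(** Induction on [n]: only the chains of top index [n] are new. There [e a] commutes past the outer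
    letter [e n], unless [a] is [n] or [n - 1], where the defining relations apply. *)
Lemma spanned_chains_stable n a x : (n <= m)%N -> (a < n)%N ->
  spanned (chains n) x -> spanned (chains n) \[e a, x].
Proof.
elim: n a x => // n IH a x nm an; apply: spanned_lie => {x} _ [i [k [ikn ->]]].
have [ikn' | nik] := ltnP (i + k) n.
  have sx : spanned (chains n) (chain i k) by apply: spanned_gen; exists i, k.
  have [-> | an'] := eqVneq a n; first exact: spanned_chains_next.
  by apply: (@spanned_chains_sub n) => //; apply: IH => //; lia.
have {ikn nik} nE : (i + k)%N = n by lia.
case: k nE => [|k] /= nE.
  rewrite addn0 in nE; rewrite nE.
  have [-> | an'] := eqVneq a n.
    by rewrite lie_bracketxx; apply: spanned_zero.
  rewrite lieC; apply/spanned_opp/spanned_chains_next => //.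
  by apply: spanned_gen; exists a, 0%N; rewrite addn0; split=> //; lia.
rewrite nE.
have sc : spanned (chains n) (chain i k).
  by apply: spanned_gen; exists i, k; split=> //; lia.
have [an1 | an1] := ltnP a.+1 n.
  rewrite lie_comm; last by rewrite lieC e_far ?oppr0.
  by apply: spanned_chains_next => //; apply: IH => //; lia.
have [aE | aE] : a = n \/ n = a.+1 by lia.
  rewrite aE; case: k nE {sc} => [|k] /= nE.
    rewrite e_adj //; [|lia|rewrite /path_adj; lia].
    apply/spanned_opp/spanned_muln/spanned_gen.
    by exists n, 0%N; rewrite addn0.
  (* The inner chain has top index [n - 2], so it commutes with [e n]. *)
  rewrite lie_ad_sq; first exact: spanned_zero.
    by rewrite e_adj //; [lia | rewrite /path_adj; lia].
  by rewrite chain_far //; lia.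
case: k nE sc => [|k] /= nE sc.
  have -> : i = a by lia.
  rewrite (lieC (e n)) lieNr e_adj ?opprK; [|lia|lia|rewrite /path_adj; lia].
  apply/spanned_muln/spanned_gen.
  by exists a, 0%N; rewrite addn0; split=> //; lia.
have ik : (i + k.+1)%N = a by lia.
(* The bracket is [A B A] on a chain of top index [a - 1], where [A = ad (e a)] and [B = ad (e n)];
   [B] kills that chain, so [lie_serre] leaves only [B A^2] and [A]. *)
rewrite ik in sc *; apply: (spanned_divn nz2); rewrite lie_serre; last first.
  by apply: e_adj; rewrite ?/path_adj; lia.
rewrite chain_far; [|lia|lia]; rewrite !lie0r add0r.
apply: spanned_add; last first.
  by apply: spanned_muln; apply: spanned_chains_sub sc; lia.
apply: spanned_chains_next => //; apply: IH => //; lia.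
Qed.

End TypeA.

(** * The action on the elements d_j, and the vanishing of their triple brackets *)

(* [d0] stands for the difference of the generators of the nodes bar 1 and 1. *)
Section TypeD.
Variables (F : fieldType) (L : lieAlgType F) (m : nat) (e : nat -> L) (d0 : L).
Hypothesis nz2 : 2%:R != 0 :> F.
Hypothesis m_gt1 : (1 < m)%N.
Hypothesis e_adj : forall a b, (a < m)%N -> (b < m)%N -> path_adj a b ->
  \[e a, \[e a, e b]] = - (e a *+ 2).
Hypothesis e_far : forall a b, (a.+1 < b)%N -> (b < m)%N -> \[e b, e a] = 0.
Hypothesis e_d0 : forall a, (a < m)%N -> a != 1%N -> \[e a, d0] = 0.
Hypothesis e1_e1_d0 : \[e 1%N, \[e 1%N, d0]] = 0.
(** The relation [[e_bar1, [e_bar1, e_2]] = -2 e_bar1] with [e_bar1 = e_1 + d0], in the form given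
    by [lie_add_ad_sq]. *)
Hypothesis e0_e1_d0 :
  \[e 0%N, \[e 1%N, d0]] *+ 2 = d0 *+ 2 - \[d0, \[e 1%N, d0]].

(** In the numbering from 1, [tail j] is d_(j+1). *)
Fixpoint tail (j : nat) : L := if j is j'.+1 then \[e j, tail j'] else d0.

Lemma e_tail_far a j : (j.+1 < a)%N -> (a < m)%N -> \[e a, tail j] = 0.
Proof.
elim: j => [|j IH] ja am /=; first by apply: e_d0; lia.
by rewrite lie_comm ?IH ?lie0r //; [lia | apply: e_far].
Qed.

(** For [j >= 2], [lie_ad_sq] applies because [e j] commutes with [tail (j - 2)]. *)
Lemma e_tail_same j : (j < m)%N -> \[e j, tail j] = 0.
Proof.
case: j => [|[|j]] jm //=; first exact: e_d0.
rewrite lie_ad_sq //; first by apply: e_adj; rewrite ?/path_adj; lia.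
exact: e_tail_far.
Qed.

(** In [lie_serre] at [tail j] the terms containing [[e j.+2, tail j]] and [[e j.+1, tail j.+1]]
    vanish. *)
Lemma e_tail_down j : (j.+2 < m)%N -> \[e j.+1, tail j.+2] = tail j.+1.
Proof.
move=> jm; apply: (mulr2n_inj nz2); rewrite /= lie_serre; last first.
  by apply: e_adj; rewrite ?/path_adj; lia.
rewrite (@e_tail_far j.+2) // (@e_tail_same j.+1 (ltnW jm)).
by rewrite !lie0r !add0r.
Qed.

(** Commuting [e a] inwards leads to [[e a, tail a.+1] = tail a], which [e a.+2] kills. *)
Lemma e_tail_below a j : (0 < a)%N -> (a.+1 < j)%N -> (j < m)%N ->
  \[e a, tail j] = 0.
Proof.
move=> a0; elim: j => // j IH aj jm /=.
rewrite lie_comm; last by rewrite lieC e_far ?oppr0.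
have [aj' | aj'] := ltnP a.+1 j; first by rewrite IH ?lie0r //; lia.
have -> : j = a.+1 by lia.
case: a a0 aj aj' {IH} => // a _ aj aj'.
by rewrite e_tail_down; [apply: e_tail_far; lia | lia].
Qed.

Lemma e_tail a j : (0 < a < m)%N -> (j < m)%N ->
  \[e a, tail j] = if path_adj a j then tail a else 0.
Proof.
move=> /andP[a0 am] jm; have [/orP[] /eqP aj | naj] := boolP (path_adj a j).
- by case: a a0 am aj => // a _ am aj; rewrite aj e_tail_down // -aj.
- by rewrite aj.
have [aj | aj | ->] := ltngtP a j; last exact: e_tail_same.
- by apply: e_tail_below => //; move: naj; rewrite /path_adj; lia.
- by apply: e_tail_far => //; move: naj; rewrite /path_adj; lia.
Qed.

(** This says that [e 0 + d0 / 2] acts on the tails like the other [e a]. The identity spreads from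
    [j = 1] by brackets with higher [e a], which commute with [e 0] and [d0]. *)
Lemma e0_tail j : (j < m)%N ->
  \[e 0%N, tail j] *+ 2
  = (if path_adj 0 j then d0 *+ 2 else 0) - \[d0, tail j].
Proof.
case: j => [_ | j]; first by rewrite e_d0 ?lie_bracketxx ?subr0 ?mul0rn //; lia.
elim: j => [|j IH] jm; first exact: e0_e1_d0.
rewrite [tail j.+2]/= lie_comm; last by rewrite lieC e_far ?oppr0.
rewrite -lieMnr IH ?lieBr; last by lia.
rewrite (@lie_comm _ _ (e j.+2) d0); last by apply: e_d0.
congr (_ - _); rewrite /path_adj /=; case: ifP => _; last by rewrite lie0r.
by rewrite lieMnr e_d0 ?mul0rn.
Qed.

(** For [k = 1], [e0_tail] replaces [ad d0] by [-2 ad (e 0)] twice, up to multiples of [d0], and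
    [lie_ad_sq] kills the result. Larger [k] follow since [e k] commutes with [d0]. *)
Lemma d0_d0_tail k : (k < m)%N -> \[d0, \[d0, tail k]] = 0.
Proof.
case: k => [_ | k]; first by rewrite lie_bracketxx lie0r.
elim: k => [|k IH] km.
  have e0d0 : \[e 0%N, d0] = 0 by apply: e_d0; lia.
  have d0d1 : \[d0, tail 1] = d0 *+ 2 - \[e 0%N, tail 1] *+ 2.
    by rewrite e0_tail //= opprB addrC subrK.
  rewrite d0d1 lieBr !lieMnr lie_bracketxx mul0rn add0r.
  rewrite -(lie_comm _ e0d0) d0d1 lieBr !lieMnr e0d0 mul0rn add0r.
  rewrite lie_ad_sq //; first by rewrite mul0rn oppr0 mul0rn oppr0.
  by apply: e_adj; rewrite /path_adj; lia.
have d0e : \[d0, e k.+2] = 0 by rewrite lieC e_d0 ?oppr0.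
rewrite [tail _]/= !(lie_comm _ d0e) IH ?lie0r //; exact: ltnW.
Qed.

(* Expand [lie_serre (e 0) (e 1)] on [tail k], using that [e 0] acts as
   [- d0 / 2] on it. *)
Lemma d0_tail1_tail k : (k < m)%N -> \[d0, \[tail 1, tail k]] = 0.
Proof.
have t00 := d0_d0_tail.
have d0e0 : \[d0, e 0%N] = 0 by rewrite lieC e_d0 ?oppr0 //; lia.
case: k => [_ | [_ | k km]].
- by rewrite [\[tail 1, _]]lieC lieNr t00 ?oppr0.
- by rewrite lie_bracketxx lie0r.
have e0k : \[e 0%N, tail k.+2] *+ 2 = - \[d0, tail k.+2].
  by rewrite e0_tail //= add0r.
have e0d0k : \[e 0%N, \[d0, tail k.+2]] = 0.
  apply: (mulr2n_inj nz2); rewrite mul0rn -(lie_comm _ d0e0) -lieMnr e0k lieNr.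
  by rewrite t00 ?oppr0.
have e0d0e1k : \[e 0%N, \[d0, \[e 1%N, tail k.+2]]] = 0.
  rewrite e_tail //; case: ifP => _; last by rewrite !lie0r.
  apply: (mulr2n_inj nz2); rewrite mul0rn -(lie_comm _ d0e0) -lieMnr e0_tail //.
  by rewrite lieBr lieMnr lie_bracketxx mul0rn t00 ?subrr.
have e0e0k : \[e 0%N, \[e 0%N, tail k.+2]] = 0.
  by apply: (mulr2n_inj nz2); rewrite mul0rn -lieMnr e0k lieNr e0d0k oppr0.
have e0e0e1k : \[e 0%N, \[e 0%N, \[e 1%N, tail k.+2]]] = 0.
  rewrite e_tail //; case: ifP => _; last by rewrite !lie0r.
  rewrite lie_ad_sq //; last by rewrite e_d0 //; lia.
  by apply: e_adj; rewrite /path_adj; lia.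
have e01 : \[e 0%N, \[e 0%N, e 1%N]] = - (e 0%N *+ 2).
  by apply: e_adj; rewrite /path_adj; lia.
have := lie_serre (tail k.+2) e01.
rewrite e0e0e1k e0e0k lie0r !add0r => serre.
have {serre} : \[e 0%N, \[e 1%N, \[d0, tail k.+2]]] = \[d0, tail k.+2].
  by apply: oppr_inj; rewrite -lieNr -(lieNr (e 1%N)) -e0k !lieMnr serre.
(* [e 0] kills [[d0, [e 1, tail k.+2]]], so the left side becomes [[e 0, [tail 1, tail k.+2]]]. *)
rewrite (lie_leibniz (e 1%N)) lie_bracketDr e0d0e1k addr0.
rewrite -[\[e 1%N, d0]]/(tail 1) (lie_leibniz (e 0%N)).
(* After doubling, [e0_tail] turns both Leibniz terms into brackets with [d0]; the two copies of [2
   [d0, tail k.+2]] cancel and the rest is the Leibniz expansion of the goal. *)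
move=> /(congr1 (fun x => x *+ 2)).
rewrite mulrnDl -(lieMnl \[e 0%N, tail 1]) -(lieMnr (tail 1)) e0k e0_tail //.
rewrite [path_adj 0 1]/= lie_bracketDl lieNl lieMnl lieNr -addrA -opprD.
move=> /(canRL (addKr _)) /eqP; rewrite addNr oppr_eq0 => /eqP <-.
exact: lie_leibniz.
Qed.

(** Bracketing the identity for [tail j.+1] with [e j.+2], which commutes with [d0], raises the
    first index; the other Leibniz term vanishes by induction. *)
Lemma d0_tail_tail j k : (j < m)%N -> (k < m)%N ->
  \[d0, \[tail j, tail k]] = 0.
Proof.
case: j => [_ | j]; first exact: d0_d0_tail.
elim: j k => [|j IH] k jm km; first exact: d0_tail1_tail.
have d0e : \[e j.+2, d0] = 0 by apply: e_d0.
have := congr1 (lie_bracket (e j.+2)) (IH k (ltnW jm) km).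
rewrite lie0r (lie_comm _ d0e) (lie_leibniz (e _)) lie_bracketDr.
rewrite -[\[e j.+2, tail j.+1]]/(tail j.+2) (@e_tail j.+2 k) //.
by case: ifP => _; rewrite ?lie0r ?IH ?addr0 //; apply: ltnW.
Qed.

(** Since [tail i.+1 = [e i.+1, tail i]] and [e i.+1] sends tails to tails or to 0, every term
    contains a triple bracket with outer factor [tail i]. *)
Lemma tail_tail_tail i j k : (i < m)%N -> (j < m)%N -> (k < m)%N ->
  \[tail i, \[tail j, tail k]] = 0.
Proof.
elim: i j k => [|i IH] j k im jm km; first exact: d0_tail_tail.
have tij a b : (a < m)%N -> (b < m)%N -> \[tail i, \[tail a, tail b]] = 0.
  by apply: IH; apply: ltnW.
rewrite [tail i.+1]/= lie_bracket_bracketl tij // lie0r sub0r.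
rewrite (lie_leibniz (e _)) lie_bracketDr !e_tail //.
by do 2 case: ifP => _;
  rewrite ?(lieC 0) ?lie0r ?tij ?oppr0 ?lie0r ?addr0 ?oppr0.
Qed.

(** * The ideal generated by [d0], and stability of the whole family under the generators *)

Definition tails (x : L) : Prop :=
  (exists2 j, (j < m)%N & x = tail j) \/
  (exists i j, [/\ (i < m)%N, (j < m)%N & x = \[tail i, tail j]]).

Lemma tails_tail j : (j < m)%N -> spanned tails (tail j).
Proof. by move=> jm; apply: spanned_gen; left; exists j. Qed.

Lemma spanned_tails_tail j x : (j < m)%N ->
  spanned tails x -> spanned tails \[tail j, x].
Proof.
move=> jm; apply: spanned_lie => _ [[k km ->] | [i [k [im km ->]]]].
  by apply: spanned_gen; right; exists j, k.
by rewrite tail_tail_tail //; apply: spanned_zero.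
Qed.

Lemma spanned_tails_e_tail a j : (a < m)%N -> (j < m)%N ->
  spanned tails \[e a, tail j].
Proof.
case: a => [_ | a am] jm.
  apply: (spanned_divn nz2); rewrite e0_tail //; apply: spanned_add.
    case: ifP => _; last exact: spanned_zero.
    by apply/spanned_muln/(@tails_tail 0); lia.
  by apply/spanned_opp/(@spanned_tails_tail 0); [lia | apply: tails_tail].
rewrite e_tail //; case: ifP => _; [exact: tails_tail | exact: spanned_zero].
Qed.

Lemma spanned_tails_e a x : (a < m)%N ->
  spanned tails x -> spanned tails \[e a, x].
Proof.
move=> am; apply: spanned_lie => _ [[j jm ->] | [i [j [im jm ->]]]].
  exact: spanned_tails_e_tail.
rewrite lie_leibniz; apply: spanned_add; last first.
  by apply: spanned_tails_tail => //; apply: spanned_tails_e_tail.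
by rewrite lieC; apply/spanned_opp/spanned_tails_tail/spanned_tails_e_tail.
Qed.

Lemma spanned_tails_chain i k x : (i + k < m)%N ->
  spanned tails x -> spanned tails \[chain e i k, x].
Proof.
elim: k x => [|k IH] x ikm /=; first by apply: spanned_tails_e; lia.
apply: spanned_stable_bracket => y; first exact: spanned_tails_e.
by apply: IH; lia.
Qed.

Definition dbasis (x : L) : Prop :=
  chains e m x \/
  (exists2 j, (j < m)%N & x = tail j) \/
  (exists i j, (i < j < m)%N /\ x = \[tail i, tail j]).

Lemma spanned_chains_dbasis x : spanned (chains e m) x -> spanned dbasis x.
Proof. by apply: spanned_sub => y cy; apply: spanned_gen; left. Qed.

Lemma spanned_tails_dbasis x : spanned tails x -> spanned dbasis x.
Proof.
apply: spanned_sub => y [[j jm ->] | [i [j [im jm ->]]]].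
  by apply: spanned_gen; right; left; exists j.
have [ij | ij | ->] := ltngtP i j.
- by apply: spanned_gen; right; right; exists i, j; rewrite ij.
- rewrite lieC; apply/spanned_opp/spanned_gen; right; right.
  by exists j, i; rewrite ij.
- by rewrite lie_bracketxx; apply: spanned_zero.
Qed.

Lemma dbasis_cases x : dbasis x -> chains e m x \/ tails x.
Proof.
move=> [cx | [[j jm ->] | [i [j [/andP[ij jm] ->]]]]]; first by left.
  by right; left; exists j.
by right; right; exists i, j; split=> //; apply: ltn_trans jm.
Qed.

Lemma spanned_dbasis_e a x : (a < m)%N ->
  spanned dbasis x -> spanned dbasis \[e a, x].
Proof.
move=> am; apply: spanned_lie => y /dbasis_cases[cy | ty].
  apply: spanned_chains_dbasis.
  apply: (spanned_chains_stable nz2 e_adj e_far (leqnn m) am).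
  exact: spanned_gen.
by apply/spanned_tails_dbasis/spanned_tails_e => //; apply: spanned_gen.
Qed.

Lemma spanned_dbasis_d0 x : spanned dbasis x -> spanned dbasis \[d0, x].
Proof.
apply: spanned_lie => y /dbasis_cases[[i [k [ikm ->]]] | ty].
  rewrite lieC; apply/spanned_opp/spanned_tails_dbasis.
  apply: spanned_tails_chain => //.
  by apply: (@tails_tail 0); lia.
apply/spanned_tails_dbasis/(@spanned_tails_tail 0); first by lia.
exact: spanned_gen.
Qed.

End TypeD.

(** * Indexing the family by a rectangle *)

Section DFamily.
Variables (F : fieldType) (L : lieAlgType F) (e : nat -> L) (d0 : L).

(* A bijection between [0, m] x [0, m) and the positive roots of D_(m+1): row 0
   holds the [d_q], and row [i.+1] the roots of A_m for [i <= q] and the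
   brackets of two tails for [i > q]. *)
Definition dvec (p q : nat) : L :=
  if p is i.+1 then
    if (i <= q)%N then chain e i (q - i) else \[tail e d0 q, tail e d0 i]
  else tail e d0 q.

End DFamily.

(** * The Lie algebra of block matrices *)

Section Model.
Variables (F : fieldType) (n : nat).
Implicit Types (X Y A B : 'M[F]_n).

(* [(X, B)] stands for the block matrix [[X, B], [0, - X^T]]. *)
Definition model : Type := ('M[F]_n * 'M[F]_n)%type.
HB.instance Definition _ := GRing.Lmodule.on model.

Definition skew_act X B : 'M[F]_n := X *m B + B *m X^T.

(** The commutator of the block matrices; on skew [B], [skew_act] is the action of [gl_n] on the
    exterior square. *)
Definition model_bracket (p q : model) : model :=
  (p.1 *m q.1 - q.1 *m p.1, skew_act p.1 q.2 - skew_act q.1 p.2).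

Lemma addmxE A B i j : (A + B) i j = A i j + B i j. Proof. by rewrite mxE. Qed.
Lemma oppmxE A i j : (- A) i j = - A i j. Proof. by rewrite mxE. Qed.
Lemma scalemxE c A i j : (c *: A) i j = c * A i j. Proof. by rewrite mxE. Qed.
Lemma zeromxE i j : (0 : 'M[F]_n) i j = 0. Proof. by rewrite mxE. Qed.

Lemma trmxD A B : (A + B)^T = A^T + B^T. Proof. exact: linearD. Qed.
Lemma trmxN A : (- A)^T = - A^T. Proof. exact: linearN. Qed.
Lemma trmxZ c A : (c *: A)^T = c *: A^T. Proof. exact: linearZ. Qed.

Local Ltac matrix_ring :=
  rewrite ?(trmxD, trmxN, trmxZ, trmx_mul);
  rewrite ?(mulmxDl, mulmxDr, mulNmx, mulmxN, mulmxA);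
  rewrite -?(scalemxAl, scalemxAr);
  apply/matrixP => i j;
  rewrite ?(addmxE, oppmxE, scalemxE, zeromxE);
  repeat match goal with
  | |- context [fun_of_matrix ?M ?i ?j] => move: (fun_of_matrix M i j) => ?
  end; ring.

Local Ltac model_ring :=
  rewrite /model_bracket /skew_act; congr (_, _); rewrite /=; matrix_ring.

Lemma model_bracketDl x y z :
  model_bracket (x + y) z = model_bracket x z + model_bracket y z.
Proof. model_ring. Qed.

Lemma model_bracketDr x y z :
  model_bracket x (y + z) = model_bracket x y + model_bracket x z.
Proof. model_ring. Qed.

Lemma model_bracketZl c x y :
  model_bracket (c *: x) y = c *: model_bracket x y.
Proof. model_ring. Qed.

Lemma model_bracketZr c x y :
  model_bracket x (c *: y) = c *: model_bracket x y.
Proof. model_ring. Qed.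

Lemma model_bracketxx x : model_bracket x x = 0.
Proof. model_ring. Qed.

Lemma model_jacobi x y z :
  model_bracket x (model_bracket y z) + model_bracket y (model_bracket z x)
    + model_bracket z (model_bracket x y) = 0.
Proof. model_ring. Qed.

HB.instance Definition _ := Lmodule_isLieAlgebra.Build F model
  model_bracketDl model_bracketDr model_bracketZl model_bracketZr
  model_bracketxx model_jacobi.

Lemma model_bracketE (p q : model) :
  \[p, q] = (p.1 *m q.1 - q.1 *m p.1, skew_act p.1 q.2 - skew_act q.1 p.2).
Proof. by []. Qed.

End Model.

(** * The generators in the model, their brackets, and coordinates *)

Section ModelD.
Variables (F : fieldType) (m : nat).

(** Natural indices avoid casts; the column is zero for [k >= m.+3]. *)
Definition basis_col (k : nat) : 'cV[F]_m.+3 := \col_i (i == k :> nat)%:R.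
Local Notation w := basis_col.

Definition unit_mx (i j : nat) : 'M[F]_m.+3 := w i *m (w j)^T.
Local Notation E := unit_mx.

Definition wedge (i j : nat) : 'M[F]_m.+3 := E i j - E j i.

(* Up to a sign, the vector [v_j] is [w j.+1], and pairing with it is the
   functional [w j + w j.+2]. *)
Definition path_mx (i j : nat) : 'M[F]_m.+3 := E i.+1 j + E i.+1 j.+2.
Local Notation P := path_mx.

Definition model_e (a : nat) : model F m.+3 := (P a a, 0).

(* Column [m.+2] records the component in [W]; making the wedge with
   [w (m.+2)] part of the element yields [[W, W] = wedge^2 W] in [model_d_d]. *)
Definition model_d (j : nat) : model F m.+3 :=
  (E j.+1 m.+2, wedge 0 j.+1 + wedge j.+1 m.+2).

Definition model_wedge (i j : nat) : model F m.+3 := (0, wedge i j).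

Lemma basis_col_dot k l : (k < m.+3)%N -> (w k)^T *m w l = 1%:M *+ (k == l).
Proof.
move=> km; apply/matrixP => i j; rewrite !ord1 !mxE (bigD1 (Ordinal km)) //=.
rewrite big1 => [|h]; last first.
  by rewrite -val_eqE /= !mxE => /negPf ->; rewrite mul0r.
by rewrite !mxE /= eqxx mul1r addr0; case: (k == l); rewrite !mxE.
Qed.

Lemma unit_mx_mul i j k l : (j < m.+3)%N -> E i j *m E k l = E i l *+ (j == k).
Proof.
move=> jm; rewrite /E -mulmxA [(w j)^T *m _]mulmxA basis_col_dot //.
by case: (j == k); rewrite ?mul1mx ?mul0mx ?mulmx0.
Qed.

Lemma unit_mx_tr i j : (E i j)^T = E j i.
Proof. by rewrite trmx_mul trmxK. Qed.

Lemma path_mx_mulE i j k l : (j < m)%N ->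
  P i j *m E k l = E i.+1 l *+ ((k == j) || (k == j.+2)).
Proof.
move=> jm; rewrite mulmxDl !unit_mx_mul; [|lia|lia].
rewrite [j == k]eq_sym [j.+2 == k]eq_sym.
by case: eqP => [-> | _]; case: eqP => //= *; rewrite ?addr0 ?add0r //; lia.
Qed.

(** The functional [w j + w j.+2] is 1 on [w k.+1] if [j] and [k] are adjacent and 0 otherwise, so
    the [P] multiply like matrix units with adjacency in place of equality. *)
Lemma path_mx_mul i j k l : (j < m)%N ->
  P i j *m P k l = P i l *+ path_adj j k.
Proof.
move=> jm; rewrite mulmxDr !path_mx_mulE // -mulrnDl.
by congr (_ *+ nat_of_bool _); rewrite /path_adj; lia.
Qed.

Lemma skew_actDr (X A B : 'M[F]_m.+3) :
  skew_act X (A + B) = skew_act X A + skew_act X B.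
Proof. by rewrite /skew_act mulmxDl mulmxDr addrACA. Qed.

Lemma skew_actBr (X A B : 'M[F]_m.+3) :
  skew_act X (A - B) = skew_act X A - skew_act X B.
Proof. by rewrite /skew_act mulmxBl mulmxBr opprD addrACA. Qed.

Lemma skew_act_path a x y : (a < m)%N ->
  skew_act (P a a) (wedge x y)
  = wedge a.+1 y *+ ((x == a) || (x == a.+2))
    + wedge x a.+1 *+ ((y == a) || (y == a.+2)).
Proof.
move=> am; rewrite /wedge !mulrnBl.
have actE u v : skew_act (P a a) (E u v) = E a.+1 v *+ ((u == a) || (u == a.+2))
    + E u a.+1 *+ ((v == a) || (v == a.+2)).
  (* [E u v *m X^T] is the transpose of [X *m E v u]. *)
  rewrite /skew_act path_mx_mulE // -[E u v in LHS]unit_mx_tr -trmx_mul.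
  rewrite path_mx_mulE //; congr (_ + _).
  by case: (_ || _); rewrite ?trmx0 ?unit_mx_tr.
by rewrite skew_actBr !actE [X in _ - X]addrC opprD addrACA.
Qed.

Lemma skew_act_unit p q x y : (q < m.+3)%N ->
  skew_act (E p q) (wedge x y)
  = wedge p y *+ (q == x) + wedge x p *+ (q == y).
Proof.
move=> qm; rewrite /wedge !mulrnBl.
have actE u v :
    skew_act (E p q) (E u v) = E p v *+ (q == u) + E u p *+ (q == v).
  rewrite /skew_act unit_mx_mul // -[E u v in X in _ + X]unit_mx_tr -trmx_mul.
  rewrite unit_mx_mul //; congr (_ + _).
  by case: (q == v); rewrite ?trmx0 ?unit_mx_tr.
by rewrite skew_actBr !actE [X in _ - X]addrC opprD addrACA.
Qed.

Lemma skew_act0 (X : 'M[F]_m.+3) : skew_act X 0 = 0.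
Proof. by rewrite /skew_act mulmx0 mul0mx addr0. Qed.

Lemma model_bracket_mx (X Y : 'M[F]_m.+3) :
  \[(X, 0) : model F m.+3, (Y, 0) : model F m.+3] = (X *m Y - Y *m X, 0).
Proof. by rewrite model_bracketE /= !skew_act0 subr0. Qed.

Lemma model_e_e a b : (a < m)%N -> (b < m)%N ->
  \[model_e a, model_e b] = ((P a b - P b a) *+ path_adj a b, 0).
Proof.
move=> am bm; rewrite model_bracket_mx !path_mx_mul // mulrnBl.
by have -> : path_adj b a = path_adj a b by rewrite /path_adj orbC.
Qed.

Lemma model_e_far a b : (a.+1 < b)%N -> (b < m)%N ->
  \[model_e b, model_e a] = 0.
Proof.
move=> ab bm; rewrite model_e_e //; last by lia.
by have -> : path_adj b a = false by rewrite /path_adj; lia.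
Qed.

Lemma path_adjnn a : path_adj a a = false.
Proof. by rewrite /path_adj; lia. Qed.

Lemma model_e_adj a b : (a < m)%N -> (b < m)%N -> path_adj a b ->
  \[model_e a, \[model_e a, model_e b]] = - (model_e a *+ 2).
Proof.
move=> am bm ab; rewrite model_e_e // ab model_bracket_mx.
rewrite mulmxBr mulmxBl !path_mx_mul // path_adjnn ab.
have -> : path_adj b a by rewrite /path_adj orbC.
rewrite sub0r subr0 -opprD; congr (_, _) => /=.
by rewrite addr0 oppr0.
Qed.

Lemma path_mul_unit a x y : (a < m)%N -> (y < m.+3)%N ->
  E x y *m P a a = (E x a + E x a.+2) *+ (y == a.+1).
Proof. by move=> am ym; rewrite mulmxDr !unit_mx_mul // -mulrnDl. Qed.

(** Column 0 meets only the functional of [a = 0], whence the wedge term. By [model_d_d] it is [-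
    [model_d 0, model_d j] / 2], in agreement with [e0_tail]. *)
Lemma model_e_d a j : (a < m)%N -> (j < m)%N ->
  \[model_e a, model_d j]
  = model_d a *+ path_adj a j + model_wedge 1 j.+1 *+ (a == 0%N).
Proof.
move=> am jm; rewrite model_bracketE /= skew_act0 subr0.
rewrite path_mx_mulE // path_mul_unit //.
have -> : (m.+2 == a.+1) = false by lia.
rewrite mulr0n subr0 skew_actDr !skew_act_path //.
have -> : (j.+1 == a) || (j.+1 == a.+2) = path_adj a j.
  by rewrite /path_adj; lia.
have -> : (m.+2 == a) || (m.+2 == a.+2) = false by lia.
have -> : (0 == a) || (0 == a.+2) = (a == 0%N) by lia.
rewrite mulr0n addr0 -addrA -mulrnDl addrC.
case: (path_adj a j); case: eqP => [-> | _];
  by congr (_, _); rewrite /= ?(mulr0n, addr0, add0r).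
Qed.

Lemma model_d_d i j : (i < m)%N -> (j < m)%N ->
  \[model_d i, model_d j] = model_wedge j.+1 i.+1 *+ 2.
Proof.
move=> im jm; rewrite model_bracketE /= !unit_mx_mul //.
rewrite (skew_actDr (E i.+1 _)) (skew_actDr (E j.+1 _)) !skew_act_unit // !eqxx.
have -> : (m.+2 == j.+1) = false by lia.
have -> : (m.+2 == i.+1) = false by lia.
rewrite subrr !mulr0n !add0r; congr (_, _) => /=; first by rewrite addr0.
by rewrite /wedge opprB.
Qed.

Lemma model_tail j : (j < m)%N -> tail model_e (model_d 0) j = model_d j.
Proof.
elim: j => // j IH jm; rewrite /= IH; last by lia.
rewrite model_e_d //; last by lia.
by rewrite addr0 /path_adj eqxx orbT.
Qed.

Lemma mulmx_commutatorDZ (A B C : 'M[F]_m.+3) c :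
  A *m (B + c *: C) - (B + c *: C) *m A
  = (A *m B - B *m A) + c *: (A *m C - C *m A).
Proof.
by rewrite mulmxDr mulmxDl -scalemxAr -scalemxAl scalerBr opprD addrACA.
Qed.

(** Up to a scalar this is the product of the vectors [v_i] and [v_(i+k)] in [S^2 W]; for [k = 0]
    the two summands would coincide and count twice. *)
Lemma model_chain i k : (i + k < m)%N ->
  chain model_e i k
  = ((if k is 0 then P i i else P (i + k) i + (- 1) ^+ k *: P i (i + k)), 0).
Proof.
elim: k => // k IH ikm; rewrite [LHS]/= IH; last by lia.
rewrite model_bracket_mx; congr (_, _).
have im : (i < m)%N by lia.
case: k ikm {IH} => [|k] ikm.
  rewrite addn1 !path_mx_mul //; last by lia.
  by rewrite /path_adj !eqxx orbT expr1 scaleN1r.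
rewrite mulmx_commutatorDZ !path_mx_mul //; try lia.
have -> : path_adj (i + k.+2) i = false by rewrite /path_adj; lia.
have -> : path_adj i (i + k.+2) = false by rewrite /path_adj; lia.
have -> : path_adj (i + k.+2) (i + k.+1) by rewrite /path_adj; lia.
have -> : path_adj (i + k.+1) (i + k.+2) by rewrite /path_adj; lia.
by rewrite !mulr0n subr0 sub0r scalerN [in RHS]exprS mulN1r scaleNr.
Qed.

(* The basis dual to the functionals [w j + w j.+2]. *)
Fixpoint dual_col (l : nat) : 'cV[F]_m.+3 :=
  if l is l'.+2 then w l - dual_col l' else w l.

Lemma unit_mx_col i j l : (j < m.+3)%N -> E i j *m w l = w i *+ (j == l).
Proof.
move=> jm; rewrite -mulmxA basis_col_dot //.
by case: (j == l); rewrite ?mulmx1 ?mulmx0.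
Qed.

Lemma path_mx_col i j l : (j < m)%N ->
  P i j *m w l = w i.+1 *+ ((j == l) || (j.+2 == l)).
Proof.
move=> jm; rewrite mulmxDl !unit_mx_col; [|lia|lia].
by case: eqP => [<- | _]; case: eqP => //= *; rewrite ?addr0 ?add0r //; lia.
Qed.

Lemma path_mx_dual i j l : (j < m)%N ->
  P i j *m dual_col l = w i.+1 *+ (j == l).
Proof.
(* Two consecutive indices are carried because [dual_col] recurses by two. *)
move=> jm; suff: P i j *m dual_col l = w i.+1 *+ (j == l) /\
    P i j *m dual_col l.+1 = w i.+1 *+ (j == l.+1) by case.
elim: l => [|l [IHl IHl1]].
  by rewrite /= !path_mx_col // eqSS !orbF.
split=> //; rewrite [dual_col _]/= mulmxBr IHl path_mx_col // !eqSS.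
have [-> | jl] := eqVneq j l; last by rewrite orbF subr0.
by rewrite orbT subrr; have -> : (l == l.+2) = false by lia.
Qed.

Lemma unit_mx_dual i l : (l < m.+2)%N -> E i m.+2 *m dual_col l = 0.
Proof.
have [k] := ubnP l; elim: k l => // k IH [|[|l]] /= lk lm.
- by rewrite unit_mx_col.
- by rewrite unit_mx_col //; have -> : (m.+2 == 1%N) = false by lia.
rewrite mulmxBr unit_mx_col // IH ?subr0; [|lia|lia].
by have -> : (m.+2 == l.+2) = false by lia.
Qed.

Lemma basis_colE k (i : 'I_m.+3) j : w k i j = (i == k :> nat)%:R.
Proof. by rewrite mxE. Qed.

Lemma unit_mxE i j (a b : 'I_m.+3) :
  E i j a b = ((a == i :> nat) && (b == j :> nat))%:R.
Proof. by rewrite mxE big_ord1 !mxE -natrM mulnb. Qed.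

(** Functionals dual to the images of [dvec] up to nonzero factors: the last column detects the
    tails, [dual_col i] the second index of a [P], and the skew part the brackets of two tails. *)
Definition model_coord (p q : nat) (x : model F m.+3) : F :=
  if p is i.+1 then
    if (i <= q)%N then (x.1 *m dual_col i) (inord q.+1) 0
    else x.2 (inord i.+1) (inord q.+1)
  else x.1 (inord q.+1) (inord m.+2).

Lemma model_coord_linear p q c x y :
  model_coord p q (c *: x + y) = c * model_coord p q x + model_coord p q y.
Proof.
case: p => [|p] /=; first by rewrite !mxE.
by case: ifP => _; rewrite ?mulmxDl -?scalemxAl !mxE.
Qed.

Lemma wedgeE x y (a b : 'I_m.+3) :
  wedge x y a b = ((a == x :> nat) && (b == y :> nat))%:R
                  - ((a == y :> nat) && (b == x :> nat))%:R.
Proof. by rewrite [LHS]mxE [X in _ + X]mxE !unit_mxE. Qed.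

Lemma path_mxE i j (a b : 'I_m.+3) :
  P i j a b = ((a == i.+1 :> nat) && (b == j :> nat))%:R
              + ((a == i.+1 :> nat) && (b == j.+2 :> nat))%:R.
Proof. by rewrite [LHS]mxE !unit_mxE. Qed.

Lemma path_mx_last i j a : (j < m)%N -> P i j a (inord m.+2) = 0.
Proof.
move=> jm; rewrite path_mxE inordK //.
have -> : (m.+2 == j) = false by lia.
have -> : (m.+2 == j.+2) = false by lia.
by rewrite !andbF addr0.
Qed.

(** The condition [p <= q.+1] singles out tails and chains; for brackets of two tails the value 2 is
    the factor in [model_d_d]. *)
Lemma model_coord_dvec p q p' q' :
  (p <= m)%N -> (q < m)%N -> (p' <= m)%N -> (q' < m)%N ->
  model_coord p q (dvec model_e (model_d 0) p' q')
  = (if (p == p') && (q == q') then if (p <= q.+1)%N then 1 else 2%:R else 0).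
Proof.
move=> pm qm p'm q'm.
have vq : (inord q.+1 : 'I_m.+3) = q.+1 :> nat by rewrite inordK //; lia.
have vz : (inord m.+2 : 'I_m.+3) = m.+2 :> nat by rewrite inordK.
rewrite /dvec; case: p' p'm => [_ | i' i'm].
  rewrite model_tail //; case: p pm => [_ | i im] /=.
    by rewrite unit_mxE vq vz eqxx andbT eqSS; case: eqP.
  case: ifP => _; first by rewrite unit_mx_dual ?mxE //; lia.
  rewrite addmxE !wedgeE vq inordK; last by lia.
  have -> : (q.+1 == m.+2) = false by lia.
  have -> : (i.+1 == m.+2) = false by lia.
  by rewrite /= !andbF !subr0 addr0.
have [i'q' | q'i'] := leqP i' q'.
  rewrite model_chain; last by lia.
  rewrite subnKC //; case: p pm => [_ | i im] /=.
    case: (q' - i')%N => [|k] /=; first by rewrite path_mx_last //; lia.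
    by rewrite addmxE scalemxE !path_mx_last ?mulr0 ?addr0 //; lia.
  have [iq | qi] := leqP i q; last first.
    by rewrite mxE; have -> : (i.+1 == i'.+1) && (q == q') = false by lia.
  rewrite ltnS iq.
  case k_def: (q' - i')%N => [|k].
    have -> : q' = i' by lia.
    rewrite path_mx_dual // eqSS [i == i']eq_sym.
    by case: (i' == i); rewrite mxE // vq eqSS; case: (q == i').
  rewrite mulmxDl -scalemxAl !path_mx_dual //.
  rewrite eqSS [i == i']eq_sym.
  case: eqP => [i'i | _] /=.
    have -> : (q' == i) = false by lia.
    by rewrite mulr0n scaler0 addr0 basis_colE vq eqSS; case: eqP.
  case: eqP => [q'i | _]; last by rewrite mulr0n scaler0 addr0 mxE.
  rewrite add0r mxE basis_colE vq eqSS.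
  (* Here [i' < q' = i <= q], so the transposed summand of the chain is not seen. *)
  have -> : (q == i') = false by lia.
  by rewrite mulr0.
rewrite !model_tail // model_d_d // mulr2n.
case: p pm => [_ | i im] /=; first by rewrite addr0 mxE.
rewrite ltnS; have [iq | qi] := leqP i q.
  rewrite addr0 mul0mx mxE.
  by have -> : (i.+1 == i'.+1) && (q == q') = false by lia.
rewrite addmxE wedgeE vq inordK ?eqSS; last by lia.
(* Both index pairs are strictly decreasing, so the transposed entry of the wedge is not met. *)
have -> : (i == q') && (q == i') = false by lia.
by rewrite subr0; case: ifP => _; rewrite ?addr0.
Qed.

End ModelD.

(** * Dimension from a spanning family with dual functionals *)

Section FiniteDimension.
Variables (F : fieldType) (V : lmodType F) (I : finType) (b : I -> V).

Lemma spanned_family S x :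
  (forall y, S y -> exists i, y = b i) -> spanned S x ->
  exists c : I -> F, x = \sum_i c i *: b i.
Proof.
move=> Sb; elim=> {x} [x /Sb[i ->] | | x y _ [c ->] _ [c' ->] | a x _ [c ->]].
- exists (fun j => (j == i)%:R); rewrite (bigD1 i) //= eqxx scale1r.
  by rewrite big1 ?addr0 // => j /negPf ->; rewrite scale0r.
- by exists (fun=> 0); rewrite big1 // => j _; rewrite scale0r.
- exists (fun j => c j + c' j); rewrite -big_split /=.
  by apply: eq_bigr => j _; rewrite scalerDl.
- exists (fun j => a * c j); rewrite scaler_sumr.
  by apply: eq_bigr => j _; rewrite scalerA.
Qed.

Lemma dual_family_free (f : I -> V -> F) :
  (forall i a x y, f i (a *: x + y) = a * f i x + f i y) ->
  (forall i, f i (b i) != 0) -> (forall i j, i != j -> f i (b j) = 0) ->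
  forall c : I -> F, \sum_i c i *: b i = 0 -> forall i, c i = 0.
Proof.
move=> flin fnz f0 c cb0 i.
have f_0 : f i 0 = 0.
  by have := flin i (- 1) 0 0; rewrite scaler0 addr0 mulN1r addNr.
have fsum : f i (\sum_j c j *: b j) = \sum_j c j * f i (b j).
  by elim/big_rec2: _ => // j y x _ <-; rewrite flin.
have := fsum; rewrite cb0 f_0 (bigD1 i) //= big1 ?addr0 => [|j ji]; last first.
  by rewrite f0 ?mulr0 // eq_sym.
by move/esym/eqP; rewrite mulf_eq0 (negPf (fnz i)) orbF => /eqP.
Qed.

Lemma has_dim_finType :
  (forall c : I -> F, \sum_i c i *: b i = 0 -> forall i, c i = 0) ->
  (forall x, exists c : I -> F, x = \sum_i c i *: b i) -> has_dim V #|I|.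
Proof.
move=> bfree bspan; exists (fun k => b (enum_val k)); split.
  move=> c; rewrite (reindex enum_rank) /=; last exact/onW_bij/enum_rank_bij.
  under eq_bigr do rewrite enum_rankK.
  by move/bfree => c0 i; rewrite -(enum_valK i) c0.
move=> x; have [c ->] := bspan x; exists (fun k => c (enum_val k)).
rewrite [RHS](reindex enum_rank) /=; last exact/onW_bij/enum_rank_bij.
by under [RHS]eq_bigr do rewrite enum_rankK.
Qed.

End FiniteDimension.

(** * The family spans the electrical Lie algebra *)

Section Electrical.
Variables (F : fieldType) (m : nat).
Hypothesis nz2 : 2%:R != 0 :> F.
Hypothesis m_gt1 : (1 < m)%N.

Local Notation L := (electrical_lieD F m.+1).

Definition elec_gen (i : 'I_m.+1) : L := lie_gen _ i.
(** For [a >= m], [inord] falls back to the node bar 1. *)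
Definition elec_e (a : nat) : L := elec_gen (inord a.+1).
Definition elec_d : L := elec_gen ord0 - elec_e 0.

Lemma elec_gen_adj (i j : 'I_m.+1) : dynkinD_adj i j ->
  \[elec_gen i, \[elec_gen i, elec_gen j]] = - (elec_gen i *+ 2).
Proof.
move=> ij; rewrite -[in RHS]scaler_nat -scaleNr.
exact: (lie_gen_rel (electrical_adj F ij)).
Qed.

Lemma elec_gen_nonadj (i j : 'I_m.+1) : i != j -> ~~ dynkinD_adj i j ->
  \[elec_gen i, elec_gen j] = 0.
Proof. move=> ij nij; exact: (lie_gen_rel (electrical_nonadj F ij nij)). Qed.

Lemma elec_e_adj a b : (a < m)%N -> (b < m)%N -> path_adj a b ->
  \[elec_e a, \[elec_e a, elec_e b]] = - (elec_e a *+ 2).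
Proof.
move=> am bm ab; apply: elec_gen_adj.
by move: ab; rewrite /dynkinD_adj /dynkinD_edge /path_adj !inordK //; lia.
Qed.

Lemma elec_e_far a b : (a.+1 < b)%N -> (b < m)%N -> \[elec_e b, elec_e a] = 0.
Proof.
move=> ab bm; apply: elec_gen_nonadj.
  by rewrite -val_eqE /= !inordK //; lia.
by rewrite /dynkinD_adj /dynkinD_edge !inordK //; lia.
Qed.

Lemma elec_e_bar a : (a < m)%N -> a != 1%N ->
  \[elec_e a, elec_gen ord0] = 0.
Proof.
move=> am a1; apply: elec_gen_nonadj; first by rewrite -val_eqE /= inordK.
by rewrite /dynkinD_adj /dynkinD_edge inordK //=; lia.
Qed.

Lemma elec_e_d a : (a < m)%N -> a != 1%N -> \[elec_e a, elec_d] = 0.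
Proof.
move=> am a1; rewrite lieBr elec_e_bar // sub0r.
case: a a1 am => [|[|a]] // _ am; first by rewrite lie_bracketxx oppr0.
by rewrite elec_e_far ?oppr0.
Qed.

Lemma elec_barE : elec_gen ord0 = elec_e 0 + elec_d.
Proof. by rewrite addrC subrK. Qed.

(** The nodes bar 1 and 1 stand in the same relation to node 2, so the difference of their
    generators is killed. *)
Lemma elec_e1_e1_d : \[elec_e 1, \[elec_e 1, elec_d]] = 0.
Proof.
rewrite !lieBr [X in _ - X]elec_e_adj; [|by []|lia|by []].
rewrite elec_gen_adj ?subrr //.
by rewrite /dynkinD_adj /dynkinD_edge inordK.
Qed.

Lemma elec_e0_e1_d : \[elec_e 0, \[elec_e 1, elec_d]] *+ 2
  = elec_d *+ 2 - \[elec_d, \[elec_e 1, elec_d]].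
Proof.
have m0 : (0 < m)%N by lia.
apply/lie_add_ad_sq; [exact: elec_e_d | exact: elec_e_adj |].
rewrite -elec_barE; apply: elec_gen_adj.
by rewrite /dynkinD_adj /dynkinD_edge inordK.
Qed.

Lemma elec_span x : spanned (dbasis m elec_e elec_d) x.
Proof.
have m0 : (0 < m)%N by lia.
set S := dbasis m elec_e elec_d.
have genE i : elec_gen i = elec_e 0 + elec_d \/
    exists2 a, (a < m)%N & elec_gen i = elec_e a.
  case: (posnP i) => [i0 | i0]; [left | right].
    by rewrite -elec_barE; congr elec_gen; apply: val_inj.
  exists i.-1; first by have := ltn_ord i; lia.
  by congr elec_gen; apply: val_inj; rewrite /= inordK prednK.
have Se a : (a < m)%N -> spanned S (elec_e a).
  by move=> am; apply: spanned_gen; left; exists a, 0%N; rewrite addn0.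
have Sd : spanned S elec_d by apply: spanned_gen; right; left; exists 0%N.
have stab_e a : (a < m)%N -> forall y, spanned S y -> spanned S \[elec_e a, y].
  move=> am y; apply: spanned_dbasis_e => //.
  - exact: elec_e_adj.
  - exact: elec_e_far.
  - exact: elec_e_d.
  - exact: elec_e1_e1_d.
  - exact: elec_e0_e1_d.
have stab_d y : spanned S y -> spanned S \[elec_d, y].
  apply: spanned_dbasis_d0 => //.
  - exact: elec_e_adj.
  - exact: elec_e_far.
  - exact: elec_e_d.
  - exact: elec_e1_e1_d.
  - exact: elec_e0_e1_d.
elim/lie_ind: x => t; rewrite -lie_eval_gen.
(* Stability of the span under the adjoint action is added to carry the induction through
   brackets. *)
suff: spanned S (lie_eval (@lie_gen _ _ _) t) /\
    forall y, spanned S y ->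
    spanned S \[lie_eval (@lie_gen _ _ _) t, y] by case.
elim: t => [i | | t [St It] | s [Ss Is] t [St It] | c t [St It] |
            s [Ss Is] t [St It]] /=.
- rewrite -/(elec_gen i); have [-> | [a am ->]] := genE i; last first.
    by split; [apply: Se | apply: stab_e].
  split=> [|y Sy]; first by apply: spanned_add; [apply: Se | ].
  by rewrite lie_bracketDl; apply: spanned_add; [apply: stab_e | apply: stab_d].
- split=> [|y Sy]; first exact: spanned_zero.
  by rewrite lieC lie0r oppr0; apply: spanned_zero.
- split=> [|y Sy]; first exact: spanned_opp.
  by rewrite lieNl; apply: spanned_opp; apply: It.
- split=> [|y Sy]; first exact: spanned_add.
  by rewrite lie_bracketDl; apply: spanned_add; [apply: Is | apply: It].
- split=> [|y Sy]; first exact: spanned_scale.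
  by rewrite lie_bracketZl; apply: spanned_scale; apply: It.
- split=> [|y Sy]; first exact: Is.
  exact: spanned_stable_bracket.
Qed.

Lemma dbasis_dvec x : dbasis m elec_e elec_d x ->
  exists pq : 'I_m.+1 * 'I_m, x = dvec elec_e elec_d pq.1 pq.2.
Proof.
case=> [[i [k [ikm ->]]] | [[j jm ->] | [i [j [/andP[ij jm] ->]]]]].
- have im : (i < m)%N by lia.
  exists (Ordinal (im : (i.+1 < m.+1)%N), Ordinal ikm).
  by rewrite /dvec /= leq_addr addKn.
- by exists (ord0, Ordinal jm).
- have im : (i < m)%N by lia.
  exists (Ordinal (jm : (j.+1 < m.+1)%N), Ordinal im).
  by rewrite /dvec /= leqNgt ij.
Qed.

(** * The homomorphism to the model, and linear independence *)

Definition model_gen (i : 'I_m.+1) : model F m.+3 :=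
  if i : nat is a.+1 then model_e F m a else model_e F m 0 + model_d F m 0.

Lemma model_wedgeC i j : model_wedge F m i j = - model_wedge F m j i.
Proof.
by rewrite /model_wedge /wedge; congr (_, _); rewrite /= ?oppr0 ?opprB.
Qed.

Lemma model_wedgexx i : model_wedge F m i i = 0.
Proof. by rewrite /model_wedge /wedge subrr. Qed.

Lemma model_e_d0 a : (a < m)%N -> a != 1%N ->
  \[model_e F m a, model_d F m 0] = 0.
Proof.
move=> am a1; rewrite model_e_d //; last by lia.
have -> : path_adj a 0 = false by rewrite /path_adj; lia.
by case: eqP => _; rewrite ?model_wedgexx mul0rn ?mulr0n addr0.
Qed.

Lemma model_e1_d0 : \[model_e F m 1, model_d F m 0] = model_d F m 1.
Proof. by rewrite model_e_d ?addr0 //; lia. Qed.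

Lemma model_bar_adj :
  \[model_e F m 0 + model_d F m 0,
    \[model_e F m 0 + model_d F m 0, model_e F m 1]]
  = - ((model_e F m 0 + model_d F m 0) *+ 2).
Proof.
have m0 : (0 < m)%N by lia.
apply/lie_add_ad_sq; [exact: model_e_d0 | exact: model_e_adj |].
(* Both sides equal [2 model_d 0 + 2 model_wedge 1 2]. *)
rewrite model_e1_d0 model_d_d // model_e_d //= mulrnDl.
by rewrite (model_wedgeC 2) mulNrn opprK.
Qed.

Lemma model_gen_rel s t : electrical_rel (@dynkinD_adj m.+1) s t ->
  lie_eval model_gen s = lie_eval model_gen t.
Proof.
have m0 : (0 < m)%N by lia.
case=> [i j | i j ij]; rewrite /dynkinD_adj /dynkinD_edge /=.
  rewrite scaleNr scaler_nat /model_gen.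
  have := ltn_ord i; have := ltn_ord j.
  case: (i : nat) (j : nat) => [|a] [|b] //= bm am adj.
  - have -> : b = 1%N by lia.
    exact: model_bar_adj.
  - have -> : a = 1%N by lia.
    rewrite !lie_bracketDr model_e1_d0 (@model_e_d _ _ 1 1) //.
    by rewrite model_e_adj ?addr0 //; lia.
  - by apply: model_e_adj; rewrite /path_adj; lia.
move: ij; rewrite -val_eqE /model_gen /=.
have := ltn_ord i; have := ltn_ord j.
case: (i : nat) (j : nat) => [|a] [|b] //= bm am ij nadj.
- rewrite lieC lie_bracketDr model_e_d0; [|lia|lia].
  case: b bm ij nadj => [|b] bm ij nadj.
    by rewrite lie_bracketxx addr0 oppr0.
  by rewrite model_e_far ?addr0 ?oppr0 //; lia.
- rewrite lie_bracketDr model_e_d0; [|lia|lia].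
  case: a am ij nadj => [|a] am ij nadj; first by rewrite lie_bracketxx addr0.
  by rewrite model_e_far ?addr0 //; lia.
- have [ab | ab | ab] := ltngtP a b; last by rewrite ab lie_bracketxx.
    by rewrite lieC model_e_far ?oppr0 //; lia.
  by rewrite model_e_far //; lia.
Qed.

(** The universal property gives a homomorphism [g] to the model taking each [dvec] to its
    counterpart; coordinates composed with [g] are dual, up to factors 1 and 2, to the spanning
    family. *)
Lemma elec_has_dim : has_dim L (m.+1 * m)%N.
Proof.
have -> : (m.+1 * m)%N = #|{: 'I_m.+1 * 'I_m}| by rewrite card_prod !card_ord.
have [g [[glin gbr ggen] _]] := presented_lie_universal model_gen_rel.
have m0 : (0 < m)%N by lia.
have ge a : (a < m)%N -> g (elec_e a) = model_e F m a.
  by move=> am; rewrite ggen /model_gen inordK.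
have g_d : g elec_d = model_d F m 0.
  have -> : elec_d = (- 1) *: elec_e 0 + elec_gen ord0.
    by rewrite scaleN1r addrC.
  by rewrite glin ge // ggen /model_gen /= scaleN1r addKr.
have gchain i k : (i + k < m)%N ->
    g (chain elec_e i k) = chain (model_e F m) i k.
  elim: k => [|k IH] ikm /=; first by rewrite ge //; lia.
  by rewrite gbr ge // IH //; lia.
have gtail j : (j < m)%N ->
    g (tail elec_e elec_d j) = tail (model_e F m) (model_d F m 0) j.
  by elim: j => [|j IH] jm //=; rewrite gbr ge // IH //; lia.
have gdvec p q : (p <= m)%N -> (q < m)%N -> g (dvec elec_e elec_d p q)
    = dvec (model_e F m) (model_d F m 0) p q.
  rewrite /dvec; case: p => [|i] pm qm; first exact: gtail.
  by case: leqP => iq; rewrite ?gbr ?gtail ?gchain //; lia.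
pose b (pq : 'I_m.+1 * 'I_m) := dvec elec_e elec_d pq.1 pq.2.
pose f (pq : 'I_m.+1 * 'I_m) (x : L) := model_coord pq.1 pq.2 (g x).
have fb pq pq' : f pq (b pq') =
    if pq == pq' then if (pq.1 <= pq.2.+1)%N then 1 else 2%:R else 0.
  by rewrite /f /b gdvec ?leq_ord // model_coord_dvec ?leq_ord.
apply: has_dim_finType; last first.
  by move=> x; apply: spanned_family (elec_span x); apply: dbasis_dvec.
apply: (dual_family_free (f := f)).
- by move=> pq a x y; rewrite /f glin model_coord_linear.
- by move=> pq; rewrite fb eqxx; case: ifP; rewrite ?oner_neq0.
- by move=> pq pq' /negPf ne; rewrite fb ne.
Qed.

End Electrical.

Theorem theorem2p22 (R : realType) (N : nat) (hN : (3 <= N)%N) :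
  has_dim (electrical_lieD (complex R) N) (N ^ 2 - N)%N.
Proof.
case: N hN => // m m_gt1.
have -> : (m.+1 ^ 2 - m.+1)%N = (m.+1 * m)%N.
  by rewrite expnS expn1 -{3}[m.+1]muln1 -mulnBr subSS subn0.
by apply: elec_has_dim; rewrite ?Num.Theory.pnatr_eq0.
Qed.
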